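(* For every $k\in\mathbb{N}\cup\{0\}$ there exists $\Psi_k\colon D_k^\omega\to L_1[0,1]$ such that, if $x$ and $y$ belong to the same vertical path, then $$\|\Psi_k(x)-\Psi_k(y)\|=d_k(x,y),$$ and if $x$ and $y$ do not belong to the same vertical path, then $$\frac{d_k(x,y)}{2}\le\|\Psi_k(x)-\Psi_k(y)\|\le d_k(x,y).$$
   Context: Countably branching diamond graphs: $D_0^\omega$ is the graph with two vertices $b,t$ joined by an edge. For $k\ge 0$, $D_{k+1}^\omega$ is obtained from $D_k^\omega$ by removing each edge $\{u,v\}$ and adding instead a countably infinite set of new vertices (disjoint sets for distinct edges), each joined by an edge to $u$ and to $v$ and to nothing else. $d_k$ is the shortest path metric on (the vertex set of) $D_k^\omega$, edges having length one. Two vertices of $D_k^\omega$ belong to the same vertical path if they are the endpoints of a path in $D_k^\omega$ along which $d_k(b,\cdot)$ is strictly increasing (from one of them to the other). *)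

(* Defs.v *)
From HB Require Import structures.
From mathcomp Require Import all_boot all_order all_algebra.
From mathcomp Require Import all_classical all_reals all_analysis.
From mathcomp Require Import measurable_realfun.

Set Implicit Arguments.
Unset Strict Implicit.
Unset Printing Implicit Defensive.
Import Order.TTheory GRing.Theory Num.Theory.
Local Open Scope classical_set_scope.
Local Open Scope ring_scope.

(* Undirected graphs: the order in which [ends] lists the two endpoints of an
   edge is irrelevant, since adjacency is symmetrized. *)
Record graph := Graph {
  vertex : Type;
  edge : Type;
  ends : edge -> vertex * vertex }.

Definition adj (G : graph) (u v : vertex G) : Prop :=
  exists e, ends e = (u, v) \/ ends e = (v, u).

(* [x :: p] lists the successive vertices of a walk, so its length is [size p].
   Vertices may repeat in a walk, but neither in one of minimal length nor in
   one along which a function strictly increases: those are paths. *)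
Definition walk (G : graph) (x : vertex G) (p : seq (vertex G))
    (y : vertex G) : Prop :=
  path (fun u v => `[< adj u v >]) x p /\ last x p = y.

Definition walk_length (G : graph) (x y : vertex G) (n : nat) : Prop :=
  exists2 p, walk x p y & size p = n.

(* The default value 0 is never used in a connected graph, in particular in
   the diamond graphs (lemma [diamond_connected] below). *)
Definition dist (G : graph) (x y : vertex G) : nat :=
  if pselect (exists n, `[< walk_length x y n >]) is left h
  then ex_minn h else 0%N.

(* [inr (e, n)] is the n-th vertex added for the edge [e]; the two edges at it,
   [(e, n, false)] and [(e, n, true)], lead to the two endpoints of [e]. *)
Definition subdivide (G : graph) : graph := {|
  vertex := vertex G + edge G * nat;
  edge := edge G * nat * bool;
  ends := fun a =>
    let: (e, n, s) := a in
    if s then (inr (e, n), inl (ends e).2)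
    else (inl (ends e).1, inr (e, n)) |}.

Inductive pole := pole_b | pole_t.

Definition diamond0 : graph := {|
  vertex := pole;
  edge := unit;
  ends := fun=> (pole_b, pole_t) |}.

Fixpoint diamond (k : nat) : graph :=
  if k is k'.+1 then subdivide (diamond k') else diamond0.

Fixpoint bottom (k : nat) : vertex (diamond k) :=
  if k is k'.+1 return vertex (diamond k) then inl (bottom k') else pole_b.

Definition ascending (k : nat) (x y : vertex (diamond k)) : Prop :=
  exists2 p, walk x p y &
    path (fun u v => dist (bottom k) u < dist (bottom k) v)%N x p.

Definition same_vertical_path (k : nat) (x y : vertex (diamond k)) : Prop :=
  ascending x y \/ ascending y x.

(* An edge is an unordered pair of distinct vertices, i.e. the type [edge]
   introduces neither loops nor multiple edges. *)
Lemma diamond_simple (k : nat) :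
  (forall e : edge (diamond k), (ends e).1 <> (ends e).2) /\
  (forall e e' : edge (diamond k),
     ends e = ends e' \/ ends e = ((ends e').2, (ends e').1) -> e = e').
Proof.
elim: k => [|k [IHl _]]; first by split=> [[]|[] []].
split=> [[[e n] []] //|[[e n] s] [[e' n'] s']] /=.
by case: s s' => [] [] /= [] // [] *; subst => //; case: (IHl e').
Qed.

Lemma walk_cat (G : graph) (x y z : vertex G) p q :
  walk x p y -> walk y q z -> walk x (p ++ q) z.
Proof. by move=> [xp <-] [yq <-]; split; rewrite ?cat_path ?xp ?last_cat. Qed.

Lemma diamond_connected (k : nat) (x y : vertex (diamond k)) :
  exists p, walk x p y.
Proof.
have walk1 (G : graph) (u v : vertex G) : adj u v -> walk u [:: v] v.
  by move=> uv; split=> //=; rewrite andbT; apply/asboolP.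
elim: k x y => [|k IH].
  by move=> [] []; [exists [::]| exists [:: pole_t]|exists [:: pole_b]|
    exists [::]]; try apply: walk1; try (by exists tt; auto); split.
pose i (v : vertex (diamond k)) : vertex (diamond k.+1) := inl v.
have walk_i u v : exists p, walk (i u) p (i v).
  have [p [up <-]] := IH u v; elim: p u up => [|w p IHp] u /=.
    by exists [::]; split.
  case/andP=> /asboolP [e eE] /IHp [q wq].
  exists ([:: inr (e, 0%N); i w] ++ q); apply: walk_cat wq.
  split=> //=; rewrite andbT; apply/andP; split; apply/asboolP.
    by case: eE => eE; [exists (e, 0%N, false)|exists (e, 0%N, true)];
      rewrite /= eE; auto.
  by case: eE => eE; [exists (e, 0%N, true)|exists (e, 0%N, false)];
    rewrite /= eE; auto.
have to_i (u : vertex (diamond k.+1)) :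
    exists v, (exists p, walk u p (i v)) /\ (exists q, walk (i v) q u).
  case: u => [u|[e n]]; first by exists u; split; exists [::].
  exists (ends e).1; split; eexists; apply: walk1;
    by exists (e, n, false); rewrite /=; auto.
move=> x y; have [u [[p xp] _]] := to_i x; have [v [_ [q vq]]] := to_i y.
by have [r ur] := walk_i u v; exists (p ++ r ++ q);
  exact: walk_cat xp (walk_cat ur vq).
Qed.

(* Lebesgue measure restricted to the unit interval, as a measure on the real
   line: its $L_1$ space is $L_1[0,1]$. *)
Definition lebesgue01 (R : realType) :
    {measure set (measurableTypeR R) -> \bar R} :=
  mrestr lebesgue_measure (measurable_itv `[0%R : R, 1%R]).

Definition L1_01 (R : realType) : Type := LspaceType1 (lebesgue01 R).

(* The norm of [f - g]; elements of [L1_01] are almost-everywhere classes, and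
   [f], [g] are coerced here to arbitrary representatives. *)
Definition L1_dist (R : realType) (f g : L1_01 R) : \bar R :=
  'N[lebesgue01 R]_1[(fun s => (f s - g s)%R%:E)]%E.

Lemma mfun_measurable (R : realType)
    (f : {mfun measurableTypeR R >-> measurableTypeR R}) :
  measurable_fun [set: measurableTypeR R] (f : measurableTypeR R -> R).
Proof. exact: (@measurable_funPT _ _ _ _ f). Qed.

Lemma L1_measurable (R : realType) (f : L1_01 R) :
  measurable_fun [set: measurableTypeR R] (f : measurableTypeR R -> R).
Proof.
pose q : {mfun_ lebesgue01 R, measurableTypeR R >-> measurableTypeR R} := f.
exact: (mfun_measurable (repr q)).
Qed.

(* [L1_dist] does not depend on the choice of representatives. *)
Lemma L1_dist_repr (R : realType) (F G : L1_01 R)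
    (f g : {mfun measurableTypeR R >-> measurableTypeR R}) :
  (F : R -> R) = f %[ae lebesgue01 R] -> (G : R -> R) = g %[ae lebesgue01 R] ->
  L1_dist F G = 'N[lebesgue01 R]_1[(fun s => (f s - g s)%R%:E)]%E.
Proof.
move=> Ff Gg; rewrite /L1_dist !Lnorm1.
apply: ae_eq_integral => //.
- apply: measurableT_comp => //; apply/measurable_EFinP.
  by apply: measurable_funB; exact: L1_measurable.
- apply: measurableT_comp => //; apply/measurable_EFinP.
  by apply: measurable_funB; exact: mfun_measurable.
- exact: (comp_ae_eq2' (fun a b => `|(a - b)%:E|%E) Ff Gg).
Qed.

(* Every measurable function with a finite norm defines an element. *)
Lemma L1_class (R : realType)
    (f : {mfun measurableTypeR R >-> measurableTypeR R}) :
  finite_norm (lebesgue01 R) 1 (f : measurableTypeR R -> R) ->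
  exists F : L1_01 R, (F : R -> R) = f %[ae lebesgue01 R].
Proof.
move=> fN.
pose q : {mfun_ lebesgue01 R, measurableTypeR R >-> measurableTypeR R} :=
  \pi_({mfun_ lebesgue01 R, measurableTypeR R >-> measurableTypeR R})%qT f.
have qf : (q : R -> R) = f %[ae lebesgue01 R].
  have /eqmodP/asboolP : q = \pi_(_)%qT (repr q) by rewrite reprK.
  exact: ae_eq_sym.
have qN : finite_norm (lebesgue01 R) 1 (q : measurableTypeR R -> R).
  move: fN; rewrite /finite_norm !Lnorm1; congr (_ < _)%E.
  apply: ae_eq_integral => //.
  - apply: measurableT_comp => //; apply/measurable_EFinP.
    exact: mfun_measurable.
  - apply: measurableT_comp => //; apply/measurable_EFinP.
    exact: (mfun_measurable (repr q)).
  - exact: (ae_eq_comp (fun a => `|a%:E|%E) (ae_eq_sym qf)).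
by exists (LebesgueSpace.Pack (LebesgueSpace.Class
  (isFinLebesgue.Build _ _ _ _ _ _ q qN))).
Qed.

(* Main.v *)
(* Decide for each vertex a side (bottom or top) at random: b and t lie on
   opposite sides, a new vertex copies the ends of its edge when they agree, and
   otherwise tosses its own fair coin. The coins are the binary digits of a
   point s of [0,1], and Psi x is 2^k times the indicator function of the event
   that x is on the top side, so that the norm of Psi x - Psi y is 2^k times
   delta(x, y), the probability that x and y are on different sides. This
   probability is 2^-k along an edge, hence Psi is 1-Lipschitz; and if
   eta x = delta(b, x), then 2^k * eta x = d(b, x), whence the equality along
   vertical paths.

   Two vertices that are not on a vertical path lie in the interval between the
   ends u and v of an edge of an earlier graph, in different branches: their
   sides are independent given that u and v are separated, so that
     delta(x, y) (eta v - eta u) =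
       (eta x - eta u) (eta v - eta y) + (eta y - eta u) (eta v - eta x).
   No conditioning is needed to prove this: delta(x, y), for a new vertex x, is
   the mean of its values at the ends of the edge of x, and both sides of the
   identity are affine in x and in y, so that it passes from one graph to the
   next. On the other hand d(x, y) is at most the length of a path through u or
   through v, and an elementary inequality gives the factor 2. *)
Require Import Defs.
From mathcomp Require Import all_boot all_order all_algebra.
From mathcomp Require Import all_classical all_reals all_analysis.
From mathcomp Require Import measurable_realfun zify ring lra.

Set Implicit Arguments.
Unset Strict Implicit.
Unset Printing Implicit Defensive.
Import Order.TTheory GRing.Theory Num.Theory.
Local Open Scope classical_set_scope.
Local Open Scope ring_scope.

(** * Translation invariance and binary digits *)

Lemma lebesgue_measure_translation (R : realType) (h : R)
    (A : set (measurableTypeR R)) : measurable A ->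
  lebesgue_measure [set s | A (s + h)] = lebesgue_measure A.
Proof.
move=> mA.
have mh : measurable_fun [set: measurableTypeR R]
    (fun s : measurableTypeR R => s + h : measurableTypeR R).
  by apply: measurable_funD => //; exact: measurable_cst.
rewrite [RHS](lebesgue_measure_unique (mu := pushforward lebesgue_measure
  (fun s : measurableTypeR R => s + h : measurableTypeR R)))//.
move=> X [[a b] _ <-] /=; rewrite /pushforward.
have -> : (fun s : measurableTypeR R => s + h : measurableTypeR R) @^-1` `]a, b]
    = `](a - h), (b - h)]%classic.
  by apply/seteqP; split=> s /=; rewrite !in_itv/= ltrBlDr lerBrDr.
rewrite !lebesgue_measure_itv/= !lte_fin ltrD2r.
by case: ifP => // _; rewrite -!EFinB; congr (_%:E); ring.
Qed.

(** For s >= 0, the binary digit of weight 2^-(i+1). Since [truncn] vanishes at negative reals, all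
    digits are false there, which makes [digit_ge] hold for every s. *)
Definition digit (R : realType) (i : nat) (s : R) : bool :=
  odd (Num.truncn (2 ^+ i.+1 * s)).

Lemma truncn_addn (R : realType) (x : R) (n : nat) : 0 <= x ->
  Num.truncn (x + n%:R) = (Num.truncn x + n)%N.
Proof.
move=> x0; apply: truncn_def; have /andP[h1 h2] := truncn_itv x0.
by rewrite -addSn !natrD lerD2r ltrD2r h1.
Qed.

Lemma truncn_mulVn (R : realType) (x : R) (d : nat) : 0 <= x -> (0 < d)%N ->
  Num.truncn (x / d%:R) = (Num.truncn x %/ d)%N.
Proof.
move=> x0 d0; apply: truncn_def; have /andP[h1 h2] := truncn_itv x0.
have d0' : 0 < d%:R :> R by rewrite ltr0n.
rewrite ler_pdivlMr// ltr_pdivrMr// -!natrM; apply/andP; split.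
  by apply: le_trans h1; rewrite ler_nat leq_divM.
by apply: lt_le_trans h2 _; rewrite ler_nat ltn_ceil.
Qed.

Lemma digit_ge (R : realType) (i : nat) (s : R) : digit i s -> (2 ^+ i.+1)^-1 <= s.
Proof.
rewrite /digit => o; rewrite -div1r ler_pdivrMr ?exprn_gt0// mulrC.
by rewrite -truncn_gt0; case: Num.truncn o.
Qed.

Lemma digit_flip (R : realType) (c : nat) (s : R) : 0 <= s ->
  digit c (s + (2 ^+ c.+1)^-1) = ~~ digit c s.
Proof.
move=> s0; rewrite /digit mulrDr divff ?expf_neq0// (truncn_addn 1) ?addn1//.
by rewrite mulr_ge0 ?exprn_ge0.
Qed.

(** Adding 2^-(c+1) where digit c is 0 causes no carry. For c < i it adds the even integer 2^(i-c)
    to 2^(i+1) s; for i < c, digit i is read off a quotient by 2^(c-i) of an even integer, and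
    adding 1 to that integer does not change the quotient. *)
Lemma digit_shift (R : realType) (i c : nat) (s : R) : 0 <= s -> i <> c ->
  ~~ digit c s -> digit i (s + (2 ^+ c.+1)^-1) = digit i s.
Proof.
move=> s0; rewrite /digit.
move=> ic; have [ci _|ic'] := ltnP c i.
  rewrite mulrDr (_ : 2 ^+ i.+1 / _ = (2 ^ (i - c))%:R :> R); last first.
    by rewrite natrX (_ : i.+1 = (i - c + c.+1)%N) ?exprD ?mulfK ?expf_neq0//; lia.
  rewrite truncn_addn ?mulr_ge0 ?exprn_ge0// oddD oddX subn_eq0 leqNgt ci /=.
  by rewrite addbF.
have {}ic : (i < c)%N by rewrite ltn_neqAle ic' andbT; apply/eqP.
have E (t : R) : 0 <= t -> Num.truncn (2 ^+ i.+1 * t) =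
    (Num.truncn (2 ^+ c.+1 * t) %/ 2 ^ (c - i))%N.
  move=> t0; rewrite -truncn_mulVn ?expn_gt0 ?mulr_ge0 ?exprn_ge0//.
  congr (Num.truncn _); rewrite natrX mulrAC; congr (_ * _).
  rewrite (_ : c.+1 = (i.+1 + (c - i))%N); last by lia.
  by rewrite exprD mulfK ?expf_neq0.
rewrite !E ?addr_ge0 ?invr_ge0 ?exprn_ge0// mulrDr divff ?expf_neq0//.
rewrite (truncn_addn 1) ?mulr_ge0 ?exprn_ge0// addn1 => ev; congr (odd _).
have -> : (2 ^ (c - i) = 2 * 2 ^ (c - i).-1)%N.
  by rewrite -expnS; congr (_ ^ _)%N; lia.
rewrite !divnMA; congr (_ %/ _)%N.
by rewrite !divn2 -uphalfE uphalf_half (negbTE ev).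
Qed.

Lemma measurable_digit (R : realType) (i : nat) :
  measurable_fun [set: measurableTypeR R] (fun s : measurableTypeR R => digit i s).
Proof.
apply: (measurable_fun_bool true); rewrite setTI.
rewrite (_ : _ @^-1` _ = \bigcup_(m in [set m | odd m])
    `[(m%:R / 2 ^+ i.+1 : R), (m.+1%:R / 2 ^+ i.+1 : R)[%classic).
  by apply: bigcup_measurable => m _; exact: measurable_itv.
have p0 : 0 < 2 ^+ i.+1 :> R by rewrite exprn_gt0.
apply/seteqP; split=> s /=.
  move=> ds; exists (Num.truncn (2 ^+ i.+1 * s)) => //=.
  rewrite in_itv/= ler_pdivrMr// ltr_pdivlMr// [s * _]mulrC; apply: truncn_itv.
  rewrite mulr_ge0 ?(ltW p0)//; apply: le_trans (digit_ge ds).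
  by rewrite invr_ge0 ltW.
move=> [m /= om]; rewrite in_itv/= ler_pdivrMr// ltr_pdivlMr// [s * _]mulrC => sm.
by rewrite /digit (truncn_def sm).
Qed.

(** * Probabilities of events on the unit interval *)

Definition pr (R : realType) (g : R -> bool) : R :=
  fine (lebesgue01 R [set s | g s]).

Definition event (R : realType) (g : R -> bool) : Prop :=
  measurable_fun [set: measurableTypeR R] (g : measurableTypeR R -> bool).

Lemma event_measurable (R : realType) (g : R -> bool) : event g ->
  measurable ([set s | g s] : set (measurableTypeR R)).
Proof.
move=> mg; have := mg measurableT [set true] I; rewrite setTI.
by congr (measurable _); apply/seteqP; split.
Qed.

Lemma eventN (R : realType) (g : R -> bool) : event g -> event (fun s => ~~ g s).
Proof. exact: measurable_neg. Qed.

Lemma eventI (R : realType) (g h : R -> bool) : event g -> event h ->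
  event (fun s => g s && h s).
Proof. exact: measurable_and. Qed.

Lemma eventU (R : realType) (g h : R -> bool) : event g -> event h ->
  event (fun s => g s || h s).
Proof. exact: measurable_or. Qed.

Lemma event_neq (R : realType) (g h : R -> bool) : event g -> event h ->
  event (fun s => g s != h s).
Proof.
move=> mg mh.
rewrite (_ : (fun s => g s != h s) = (fun s => g s && ~~ h s || ~~ g s && h s)).
  by apply: eventU; apply: eventI => //; apply: eventN.
by apply/funext => s; case: (g s); case: (h s).
Qed.

Lemma lebesgue01E (R : realType) (A : set (measurableTypeR R)) :
  lebesgue01 R A = lebesgue_measure (A `&` `[0, 1]).
Proof. by []. Qed.

Lemma lebesgue01_setT (R : realType) : lebesgue01 R [set: R] = 1%E.
Proof.
by rewrite lebesgue01E setTI lebesgue_measure_itv/= lte_fin ltr01 oppr0 adde0.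
Qed.

Lemma pr_fin (R : realType) (g : R -> bool) : event g ->
  lebesgue01 R [set s | g s] = (pr g)%:E.
Proof.
move=> mg; rewrite fineK// ge0_fin_numE//.
apply: le_lt_trans (ltry 1); rewrite -lebesgue01_setT.
by apply: le_measure; rewrite ?inE//; exact: event_measurable.
Qed.

Lemma eq_pr (R : realType) (g h : R -> bool) : g =1 h -> pr g = pr h.
Proof. by move=> /funext ->. Qed.

Lemma pr_ge0 (R : realType) (g : R -> bool) : 0 <= pr g.
Proof. by rewrite fine_ge0. Qed.

Lemma pr_predT (R : realType) : pr (fun _ : R => true) = 1.
Proof.
rewrite /pr (_ : [set s | _] = setT) ?lebesgue01_setT//.
by apply/seteqP; split.
Qed.

Lemma pr_pred0 (R : realType) : pr (fun _ : R => false) = 0.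
Proof.
rewrite /pr (_ : [set s | _] = set0) ?measure0//.
by apply/seteqP; split.
Qed.

Lemma pr_split (R : realType) (g w : R -> bool) : event g -> event w ->
  pr g = pr (fun s => g s && w s) + pr (fun s => g s && ~~ w s).
Proof.
move=> mg mw; apply: EFin_inj; rewrite EFinD -(pr_fin mg) -(pr_fin (eventI mg mw)).
rewrite -(pr_fin (eventI mg (eventN mw))) [RHS]addeC.
rewrite (measureDI _ (event_measurable mg) (event_measurable mw)).
congr (lebesgue01 R _ + lebesgue01 R _)%E.
- by apply/seteqP; split => s /=; [case=> -> /negP|case/andP=> -> /negP].
- by apply/seteqP; split => s /=; [case=> -> |case/andP].
Qed.

Lemma pr_modular (R : realType) (g h : R -> bool) : event g -> event h ->
  pr g + pr h = pr (fun s => g s || h s) + pr (fun s => g s && h s).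
Proof.
move=> mg mh; rewrite (pr_split mg mh) (pr_split (eventU mg mh) mh).
rewrite (eq_pr (h := h) (g := fun s => (g s || h s) && h s)); last first.
  by move=> s; case: (g s); case: (h s).
rewrite (eq_pr (h := fun s => g s && ~~ h s) (g := fun s => (g s || h s) && ~~ h s)).
  by ring.
by move=> s; case: (g s); case: (h s).
Qed.

Lemma le_pr (R : realType) (g h : R -> bool) : event g -> event h ->
  (forall s, g s -> h s) -> pr g <= pr h.
Proof.
move=> mg mh gh; rewrite [leRHS](pr_split mh mg).
rewrite (eq_pr (h := g)) ?lerDl ?pr_ge0// => s.
by case: (g s) (gh s) => [->|] //; rewrite andbF.
Qed.

(** The point 1 is a null set. Dropping it leaves a half-open interval, on which the translation in
    [pr_half] has no exceptional endpoint. *)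
Lemma lebesgue01_itvco (R : realType) (g : R -> bool) : event g ->
  lebesgue01 R [set s | g s] =
  lebesgue_measure [set s : measurableTypeR R | [&& 0 <= s, s < 1 & g s]].
Proof.
move=> mg; rewrite lebesgue01E.
have mco : event (fun s : R => [&& 0 <= s, s < 1 & g s]).
  apply: eventI; [|apply: eventI] => //.
    by apply: measurable_fun_ler => //; exact: measurable_cst.
  by apply: measurable_fun_ltr => //; exact: measurable_cst.
rewrite (_ : _ `&` _ = [set s : measurableTypeR R | [&& 0 <= s, s < 1 & g s]] `|`
  ([set s | g s] `&` [set 1])).
  rewrite measureU0//; first exact: event_measurable.
    by apply: measurableI; [exact: event_measurable|exact: measurable_set1].
  apply: (@subset_measure0 _ _ _ lebesgue_measure _
    ([set 1] : set (measurableTypeR R))) => //.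
    by apply: measurableI; [exact: event_measurable|exact: measurable_set1].
  exact: lebesgue_measure_set1.
apply/seteqP; split => s /=; rewrite in_itv/=.
  move=> [-> /andP[-> s1]]; rewrite andbT.
  by move: s1; rewrite le_eqVlt => /predU1P[->|->]; auto.
by move=> [/and3P[-> /ltW -> ->]|[-> ->]] //; rewrite ler01 lexx.
Qed.

(* The translation by 2^-(c+1) carries the part of [0, 1[ where the digit of
   index c is 0 onto the part where it is 1. *)
Lemma pr_half (R : realType) (c : nat) (g : R -> bool) : event g ->
  (forall s, 0 <= s -> ~~ digit c s -> g (s + (2 ^+ c.+1)^-1) = g s) ->
  pr (fun s => g s && digit c s) = pr (fun s => g s && ~~ digit c s).
Proof.
move=> mg gE; set h := (2 ^+ c.+1)^-1 in gE *.
have mW : event (fun s : R => g s && digit c s).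
  by apply: eventI => //; exact: measurable_digit.
have mW' : event (fun s : R => g s && ~~ digit c s).
  by apply: eventI => //; apply: eventN; exact: measurable_digit.
rewrite /pr !lebesgue01_itvco//; congr fine.
rewrite -(lebesgue_measure_translation h).
  congr (lebesgue_measure _); apply/seteqP; split => s /=.
    move=> /and4P[sh0 sh1 gsh dsh].
    have s0 : 0 <= s by have := digit_ge dsh; rewrite lerDr.
    have ds : ~~ digit c s by rewrite -(digit_flip _ s0).
    rewrite s0 -(gE _ s0 ds) gsh ds !andbT /=; apply: le_lt_trans sh1.
    by rewrite lerDl invr_ge0 exprn_ge0.
  move=> /and4P[s0 s1 gs ds].
  rewrite addr_ge0 ?invr_ge0 ?exprn_ge0// gE// gs (digit_flip _ s0) ds.
  rewrite !andbT /=.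
  have p0 : 0 < 2 ^+ c.+1 :> R by rewrite exprn_gt0.
  have E : (2 ^ c.+1)%:R = 2 ^+ c.+1 :> R by rewrite natrX.
  have x0 : 0 <= 2 ^+ c.+1 * s by rewrite mulr_ge0 // ltW.
  have t1 : (Num.truncn (2 ^+ c.+1 * s) < 2 ^ c.+1)%N.
    by rewrite truncn_lt_nat// E -[ltRHS]mulr1 ltr_pM2l.
  (* The translate stays below 1: the integer part m of 2^(c+1) s is less than 2^(c+1), and m + 1 =
     2^(c+1) would make m odd, against digit c being 0. *)
  rewrite -(ltr_pM2l p0) mulr1 mulrDr divff ?gt_eqF// -E -ltrBrDr.
  apply: lt_le_trans (truncnS_gt _) _; rewrite lerBrDr natr1 ler_nat E.
  rewrite ltn_neqAle t1 andbT; apply: contra ds => /eqP mE.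
  by rewrite /digit -[odd _]negbK -/(odd _.+1) mE oddX.
apply: event_measurable; apply: eventI; [|apply: eventI] => //.
  by apply: measurable_fun_ler => //; exact: measurable_cst.
by apply: measurable_fun_ltr => //; exact: measurable_cst.
Qed.

(** * Coins and random sides of the vertices *)

Fixpoint edge_code (k : nat) : edge (diamond k) -> nat :=
  match k return edge (diamond k) -> nat with
  | 0 => fun=> 0%N
  | k'.+1 => fun a => let: (e, n, s) := a in pickle (edge_code e, n, s)
  end.

Lemma edge_code_inj (k : nat) : injective (@edge_code k).
Proof.
elim: k => [[] []|k IH [[e n] s] [[e' n'] s']] //= /(pcan_inj pickleK).
by case=> /IH -> -> ->.
Qed.

(* The components k and e make all the coins, also at different levels,
   distinct digits. *)
Definition coin (k : nat) (e : edge (diamond k)) (n : nat) : nat :=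
  pickle (k, edge_code e, n).

Fixpoint side (R : realType) (s : R) (k : nat) : vertex (diamond k) -> bool :=
  match k return vertex (diamond k) -> bool with
  | 0 => fun x => if x is pole_t then true else false
  | k'.+1 => fun x =>
      match x with
      | inl u => side s u
      | inr (e, n) =>
          if side s (ends e).1 == side s (ends e).2 then side s (ends e).1
          else digit (coin e n) s
      end
  end.

Lemma side_event (R : realType) (k : nat) (x : vertex (diamond k)) :
  event (fun s : R => side s x).
Proof.
elim: k x => [|k IH] /=; first by move=> []; exact: measurable_cst.
move=> [u|[e n]] /=; first exact: IH.
(* A new vertex follows the majority among its two ends and its coin. *)
rewrite (_ : (fun _ => _) = (fun s : R =>
    (side s (ends e).1 && side s (ends e).2) ||
    (digit (coin e n) s && (side s (ends e).1 || side s (ends e).2)))).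
  apply: eventU; first exact: eventI.
  apply: eventI; last exact: eventU.
  exact: measurable_digit.
by apply/funext => s; do 2!case: (side s _) => //=; case: digit.
Qed.

(** Sides in D_k are computed from coins of levels below k only; when c is not the digit of such a
    coin, the shift alters none of the digits read. *)
Lemma side_shift (R : realType) (c k : nat) (x : vertex (diamond k)) (s : R) :
  (forall j a n : nat, (j < k)%N -> pickle (j, a, n) <> c) ->
  0 <= s -> ~~ digit c s -> side (s + (2 ^+ c.+1)^-1) x = side s x.
Proof.
move=> + s0 ds; elim: k x => [|k IH] // [u|[e n]] /= kc.
  by apply: IH => j a m jk; apply: kc; exact: ltnW.
rewrite !IH; try by move=> j a m jk; apply: kc; exact: ltnW.
by rewrite (digit_shift s0)//; exact: kc.
Qed.

(** * The separation probability delta and the height eta *)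

Definition cut_dist (R : realType) (k : nat) (x y : vertex (diamond k)) : R :=
  pr (fun s : R => side s x != side s y).

Lemma cut_distC (R : realType) (k : nat) (x y : vertex (diamond k)) :
  cut_dist R x y = cut_dist R y x.
Proof. by apply: eq_pr => s; rewrite eq_sym. Qed.

Lemma cut_distxx (R : realType) (k : nat) (x : vertex (diamond k)) :
  cut_dist R x x = 0.
Proof. by rewrite -(pr_pred0 R); apply: eq_pr => s; rewrite eqxx. Qed.

Lemma cut_dist_triangle (R : realType) (k : nat) (x y z : vertex (diamond k)) :
  cut_dist R x z <= cut_dist R x y + cut_dist R y z.
Proof.
have ev (u v : vertex (diamond k)) : event (fun s : R => side s u != side s v).
  by apply: event_neq; exact: side_event.
rewrite [leRHS]pr_modular//; apply: ler_wpDr; first exact: pr_ge0.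
apply: le_pr => // [|s]; first exact: eventU.
by do 3!case: (side s _).
Qed.

(** With p and q the sides of the two ends, the new vertex is on side p or q when its coin is 1 and
    on side p and q when it is 0. The coin is fair and independent of p, q and the side of y, so the
    two cases are averaged. *)
Lemma cut_dist_inr (R : realType) (k : nat) (e : edge (diamond k)) (n : nat)
    (y : vertex (diamond k.+1)) : inr (e, n) <> y ->
  cut_dist R (inr (e, n) : vertex (diamond k.+1)) y =
  (cut_dist R (inl (ends e).1 : vertex (diamond k.+1)) y +
   cut_dist R (inl (ends e).2 : vertex (diamond k.+1)) y) / 2.
Proof.
move=> ny; pose c := coin e n.
pose p (s : R) := side s (ends e).1; pose q (s : R) := side s (ends e).2.
pose z (s : R) := side s y.
pose G1 s := (p s || q s) != z s; pose G0 s := (p s && q s) != z s.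
have [pE qE zE] : [/\ event p, event q & event z] by split; exact: side_event.
have G1E : event G1 by apply: event_neq => //; exact: eventU.
have G0E : event G0 by apply: event_neq => //; exact: eventI.
have dE : event (digit c : R -> bool) by exact: measurable_digit.
have lt_c (j a m : nat) : (j < k)%N -> pickle (j, a, m) <> c.
  by move=> jk /(pcan_inj pickleK) [jE]; rewrite jE ltnn in jk.
have pS s : 0 <= s -> ~~ digit c s -> p (s + (2 ^+ c.+1)^-1) = p s.
  exact: side_shift.
have qS s : 0 <= s -> ~~ digit c s -> q (s + (2 ^+ c.+1)^-1) = q s.
  exact: side_shift.
(* If y is itself a new vertex, it differs from [inr (e, n)], so its coin is another digit. *)
have zS s : 0 <= s -> ~~ digit c s -> z (s + (2 ^+ c.+1)^-1) = z s.
  move=> s0 ds; rewrite /z; case: y ny {z zE G1 G0 G1E G0E} => [u|[e' n']] ny /=.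
    exact: side_shift.
  rewrite !side_shift// (digit_shift s0)//.
  by move=> /(pcan_inj pickleK) [/edge_code_inj eE nE]; apply: ny; rewrite eE nE.
have G1h : pr G1 = 2 * pr (fun s => G1 s && digit c s).
  rewrite (pr_split G1E dE) -(@pr_half _ c)//; first by ring.
  by move=> s s0 ds; rewrite /G1 pS// qS// zS.
have G0h : pr G0 = 2 * pr (fun s => G0 s && ~~ digit c s).
  rewrite (pr_split G0E dE) (@pr_half _ c)//; first by ring.
  by move=> s s0 ds; rewrite /G0 pS// qS// zS.
have -> : cut_dist R (inr (e, n) : vertex (diamond k.+1)) y =
    pr (fun s => G1 s && digit c s) + pr (fun s => G0 s && ~~ digit c s).
  rewrite [LHS](pr_split (w := digit c))//; last first.
    by apply: event_neq => //; exact: side_event.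
  by congr (_ + _); apply: eq_pr => s;
    rewrite /G1 /G0 /z /p /q /= /c; case: (side s (ends e).1); case: (side s (ends e).2);
    case: (digit _ s); rewrite ?andbF.
have -> : cut_dist R (inl (ends e).1 : vertex (diamond k.+1)) y =
    pr (fun s => p s != z s) by apply: eq_pr.
have -> : cut_dist R (inl (ends e).2 : vertex (diamond k.+1)) y =
    pr (fun s => q s != z s) by apply: eq_pr.
rewrite [X in _ = X / 2]pr_modular; try exact: event_neq.
(* At each s, the pair (p or q, p and q) is a rearrangement of (p, q). *)
have <- : pr G1 + pr G0 = pr (fun s => (p s != z s) || (q s != z s)) +
    pr (fun s => (p s != z s) && (q s != z s)).
  rewrite pr_modular//; congr (_ + _); apply: eq_pr => s; rewrite /G1 /G0;
    by case: (p s); case: (q s); case: (z s).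
by rewrite G1h G0h; field.
Qed.

(** By [dist_bottom], this is the distance from the bottom divided by 2^k. *)
Definition height (R : realType) (k : nat) (x : vertex (diamond k)) : R :=
  cut_dist R (Defs.bottom k) x.

Lemma height_inr (R : realType) (k : nat) (e : edge (diamond k)) (n : nat) :
  height R (inr (e, n) : vertex (diamond k.+1)) =
  (height R (ends e).1 + height R (ends e).2) / 2.
Proof.
rewrite /height cut_distC cut_dist_inr//.
by rewrite ![cut_dist R _ (Defs.bottom _)]cut_distC.
Qed.

(** By averaging, a new vertex is at the mean of 0 and 2^-k from either end of its edge, and its
    height is midway between theirs. *)
Lemma cut_dist_edge (R : realType) (k : nat) (e : edge (diamond k)) :
  cut_dist R (ends e).1 (ends e).2 = (2 ^+ k)^-1 /\
  height R (ends e).2 = height R (ends e).1 + (2 ^+ k)^-1.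
Proof.
elim: k e => [|k IH] /=.
  move=> _; rewrite /height cut_distxx invr1 add0r.
  by split; rewrite -(pr_predT R); exact: eq_pr.
have P : 2 ^+ k != 0 :> R by rewrite expf_neq0.
case=> [[e n] s]; have [dE hE] := IH e.
have uE (u v : vertex (diamond k)) : cut_dist R (inl u : vertex (diamond k.+1)) (inl v) =
  cut_dist R u v by [].
have hu (u : vertex (diamond k)) :
  height R (inl u : vertex (diamond k.+1)) = height R u by [].
rewrite exprS invfM; case: s => /=; rewrite height_inr hu hE.
  rewrite cut_dist_inr// !uE cut_distxx dE; split; first by field.
  by field.
rewrite cut_distC cut_dist_inr// !uE cut_distxx [cut_dist R _ (ends e).1]cut_distC dE.
by split; field.
Qed.

Lemma height_edge (R : realType) (k : nat) (e : edge (diamond k)) :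
  height R (ends e).2 = height R (ends e).1 + (2 ^+ k)^-1.
Proof. by have [] := cut_dist_edge R e. Qed.

(** * Ascending paths and the graph distance *)

(* In the diamond graphs, [ends e] lists the endpoint closer to the bottom
   first, so these paths are the ascending ones. *)
Definition up_path (G : graph) (x : vertex G) (p : seq (vertex G))
    (y : vertex G) : Prop :=
  path (fun u v => `[< exists e, ends e = (u, v) >]) x p /\ last x p = y.

Definition up (G : graph) (x y : vertex G) : Prop := exists p, up_path x p y.

Lemma up_refl (G : graph) (x : vertex G) : up x x.
Proof. by exists [::]. Qed.

Lemma up_edge (G : graph) (e : edge G) : up (ends e).1 (ends e).2.
Proof.
exists [:: (ends e).2]; split => //=; rewrite andbT; apply/asboolP; exists e.
exact: surjective_pairing.
Qed.

Lemma up_trans (G : graph) (x y z : vertex G) : up x y -> up y z -> up x z.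
Proof.
by move=> [p [xp <-]] [q [yq <-]]; exists (p ++ q); split;
  rewrite ?cat_path ?xp ?last_cat.
Qed.

Lemma up_inl (k : nat) (u v : vertex (diamond k)) : up u v ->
  up (inl u : vertex (diamond k.+1)) (inl v).
Proof.
case=> p [+ <-]; elim: p u => [|w p IH] u /=; first by move=> _; exact: up_refl.
case/andP=> /asboolP[e eE] /IH; apply: up_trans.
(* Each edge of the path is replaced by its two halves through the added vertex of index 0. *)
have := up_trans (@up_edge (diamond k.+1) (e, 0%N, false))
  (@up_edge (diamond k.+1) (e, 0%N, true)).
by rewrite /= eE.
Qed.

Lemma up_walk (G : graph) (x y : vertex G) p : up_path x p y -> walk x p y.
Proof.
move=> [xp xy]; split => //; apply: sub_path xp => u v /asboolP[e eE].
by apply/asboolP; exists e; left.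
Qed.

Lemma up_path_size (R : realType) (k : nat) (x y : vertex (diamond k)) p :
  up_path x p y -> (size p)%:R = 2 ^+ k * (height R y - height R x).
Proof.
case=> + <-; elim: p x => [|w p IH] x /=; first by rewrite subrr mulr0.
case/andP=> /asboolP[e eE] /IH.
have := height_edge R e; rewrite eE /= => -> hp.
by rewrite -natr1 hp !mulrBr mulrDr mulfV ?expf_neq0//; ring.
Qed.

Lemma dist_le_size (G : graph) (x y : vertex G) p : walk x p y ->
  (dist x y <= size p)%N.
Proof.
move=> xpy; rewrite /dist; case: pselect => // h; case: ex_minnP => m _; apply.
by apply/asboolP; exists p.
Qed.

Lemma dist_walk (k : nat) (x y : vertex (diamond k)) :
  exists2 p, walk x p y & size p = dist x y.
Proof.
rewrite /dist; case: pselect => [h|[]]; first by case: ex_minnP => m /asboolP.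
by have [p xpy] := diamond_connected x y; exists (size p); apply/asboolP; exists p.
Qed.

(** Every edge contributes 2^-k, and the triangle inequality adds these up. *)
Lemma cut_dist_walk (R : realType) (k : nat) (x y : vertex (diamond k)) p :
  walk x p y -> 2 ^+ k * cut_dist R x y <= (size p)%:R.
Proof.
case=> + <-; elim: p x => [|w p IH] x /=; first by rewrite cut_distxx mulr0.
case/andP=> /asboolP[e eE] /IH hp.
have xw : 2 ^+ k * cut_dist R x w = 1.
  have [+ _] := cut_dist_edge R e; case: eE => -> /= => [->|].
    by rewrite mulfV ?expf_neq0.
  by rewrite cut_distC => ->; rewrite mulfV ?expf_neq0.
have := cut_dist_triangle R x w (last w p).
rewrite -(ler_pM2l (x := 2 ^+ k)) ?exprn_gt0// mulrDr xw => /le_trans; apply.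
by rewrite -[leRHS]nat1r lerD2l.
Qed.

Lemma cut_dist_le_dist (R : realType) (k : nat) (x y : vertex (diamond k)) :
  2 ^+ k * cut_dist R x y <= (dist x y)%:R.
Proof. by have [p xpy <-] := dist_walk x y; exact: cut_dist_walk xpy. Qed.

Lemma dist_up (R : realType) (k : nat) (x y : vertex (diamond k)) : up x y ->
  (dist x y)%:R <= 2 ^+ k * (height R y - height R x).
Proof.
by case=> p xpy; rewrite -(up_path_size R xpy) ler_nat; exact/dist_le_size/up_walk.
Qed.

Lemma dist_trans (k : nat) (x y z : vertex (diamond k)) :
  (dist x z <= dist x y + dist y z)%N.
Proof.
have [p xpy <-] := dist_walk x y; have [q yqz <-] := dist_walk y z.
by rewrite -size_cat; apply: dist_le_size; exact: walk_cat yqz.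
Qed.

Lemma walk_rev (G : graph) (x y : vertex G) p : walk x p y ->
  exists2 q, walk y q x & size q = size p.
Proof.
case=> + <-; elim: p x => [|w p IH] x /=; first by exists [::].
case/andP=> /asboolP[e eE] /IH[q yqw <-]; exists (q ++ [:: x]); last first.
  by rewrite size_cat addn1.
apply: walk_cat yqw _; split=> //=; rewrite andbT; apply/asboolP; exists e.
by case: eE; [right|left].
Qed.

Lemma dist_sym (k : nat) (x y : vertex (diamond k)) : dist x y = dist y x.
Proof.
suff le u v : (@dist (diamond k) u v <= dist v u)%N by apply/eqP; rewrite eqn_leq !le.
have [p /walk_rev[q uqv <-] <-] := dist_walk v u; exact: dist_le_size.
Qed.

Lemma up_bottom (k : nat) (x : vertex (diamond k)) : up (Defs.bottom k) x.
Proof.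
elim: k x => [|k IH] /=.
  by move=> []; [exact: up_refl|exact: (@up_edge diamond0 tt)].
move=> [u|[e n]]; first exact/up_inl/IH.
exact: up_trans (up_inl (IH (ends e).1)) (@up_edge (diamond k.+1) (e, n, false)).
Qed.

(** An ascending path from the bottom gives one inequality, the Lipschitz bound the other. *)
Lemma dist_bottom (R : realType) (k : nat) (x : vertex (diamond k)) :
  (dist (Defs.bottom k) x)%:R = 2 ^+ k * height R x.
Proof.
apply: le_anti; rewrite cut_dist_le_dist andbT.
apply: le_trans (dist_up R (up_bottom x)) _.
by rewrite ler_pM2l ?exprn_gt0// {2}/height cut_distxx subr0.
Qed.

Lemma up_ascending (R : realType) (k : nat) (x y : vertex (diamond k)) :
  up x y -> ascending x y.
Proof.
case=> p xpy; exists p; first exact: up_walk.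
case: xpy => [+ _]; apply: sub_path => u v /asboolP[e eE].
have := height_edge R e; rewrite eE /= => hE.
rewrite -(ltr_nat R) !dist_bottom hE ltr_pM2l ?exprn_gt0// ltrDl.
by rewrite invr_gt0 exprn_gt0.
Qed.

Lemma dist_ascending (R : realType) (k : nat) (x y : vertex (diamond k)) :
  ascending x y -> (dist x y)%:R <= 2 ^+ k * (height R y - height R x).
Proof.
case=> p xpy; have : (dist x y)%:R <= (size p)%:R :> R.
  by rewrite ler_nat; exact: dist_le_size.
move=> /le_trans le_dist up_p; apply: le_dist; move: xpy up_p => [+ <-].
elim: p x => [|w p IH] x /=; first by rewrite subrr mulr0.
move=> /andP[/asboolP[e eE] wp] /andP[xw /(IH _ wp) hp].
have [E|E] := eE; have := height_edge R e; rewrite E /= => hE.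
  rewrite -natr1; apply: le_trans (lerD hp (lexx _)) _; rewrite hE.
  by rewrite !mulrBr mulrDr mulfV ?expf_neq0// opprD addrA subrK.
(* An edge traversed from its second end to its first would decrease the distance from the
   bottom. *)
move: xw; rewrite -(ltr_nat R) !dist_bottom hE ltr_pM2l ?exprn_gt0// gtrDl.
by rewrite ltNge invr_ge0 exprn_ge0.
Qed.

(** The triangle inequality at the bottom bounds the height difference by the cut distance, which
    complements the Lipschitz bound. *)
Lemma ascending_cut_dist (R : realType) (k : nat) (x y : vertex (diamond k)) :
  ascending x y -> 2 ^+ k * cut_dist R x y = (dist x y)%:R.
Proof.
move=> /(dist_ascending R) h; apply: le_anti; rewrite cut_dist_le_dist /=.
apply: le_trans h _; rewrite ler_pM2l ?exprn_gt0// lerBlDl.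
exact: cut_dist_triangle.
Qed.

(** * Pairs of edges in different branches *)

(** When L = eta v - eta u is positive and p, q are the relative heights of x and y between u and v,
    this says delta(x, y) = L (p (1 - q) + q (1 - p)). *)
Definition separated (R : realType) (k : nat) (u v x y : vertex (diamond k)) : Prop :=
  cut_dist R x y * (height R v - height R u) =
  (height R x - height R u) * (height R v - height R y) +
  (height R y - height R u) * (height R v - height R x).

Lemma separated_sym (R : realType) (k : nat) (u v x y : vertex (diamond k)) :
  separated R u v x y -> separated R u v y x.
Proof. by rewrite /separated cut_distC => ->; rewrite addrC. Qed.

Lemma separated_inr (R : realType) (k : nat) (u v : vertex (diamond k.+1))
    (e : edge (diamond k)) (n : nat) (y : vertex (diamond k.+1)) :
  inr (e, n) <> y ->
  separated R u v (inl (ends e).1) y -> separated R u v (inl (ends e).2) y ->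
  separated R u v (inr (e, n)) y.
Proof.
move=> ny; rewrite /separated cut_dist_inr// height_inr.
have hu (w : vertex (diamond k)) :
  height R (inl w : vertex (diamond k.+1)) = height R w by [].
by rewrite !hu => s1 s2; rewrite mulrAC mulrDl s1 s2; field.
Qed.

Definition endpoint (G : graph) (e : edge G) (b : bool) : vertex G :=
  if b then (ends e).2 else (ends e).1.

Lemma endpoint_subdivide (k : nat) (e : edge (diamond k)) (n : nat) (s b : bool) :
  endpoint ((e, n, s) : edge (diamond k.+1)) b =
  if s == b then inl (endpoint e b) else inr (e, n).
Proof. by case: s; case: b. Qed.

(** Stated for edges because subdivision acts on them. The case e = f is allowed: it is where two
    branches of the next graph start. *)
Definition branched (R : realType) (k : nat) (e f : edge (diamond k))
    (u v : vertex (diamond k)) : Prop :=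
  [/\ up u (ends e).1 /\ up (ends e).2 v, up u (ends f).1 /\ up (ends f).2 v &
      forall b c, separated R u v (endpoint e b) (endpoint f c)].

Lemma up_subedge (k : nat) (u v : vertex (diamond k)) (e : edge (diamond k))
    (n : nat) (s : bool) :
  up u (ends e).1 /\ up (ends e).2 v ->
  let a : edge (diamond k.+1) := (e, n, s) in
  @up (diamond k.+1) (inl u) (ends a).1 /\ @up (diamond k.+1) (ends a).2 (inl v).
Proof.
move=> [/up_inl ue /up_inl ev].
have h1 := @up_edge (diamond k.+1) (e, n, false).
have h2 := @up_edge (diamond k.+1) (e, n, true).
by case: s; split => //=; [exact: up_trans ue h1|exact: up_trans h2 ev].
Qed.

Lemma branched_subdivide (R : realType) (k : nat) (e f : edge (diamond k))
    (u v : vertex (diamond k)) (n m : nat) (s t : bool) :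
  branched R e f u v -> (e, n) <> (f, m) ->
  @branched R k.+1 (e, n, s) (f, m, t) (inl u) (inl v).
Proof.
move=> [ue uf sep] ne; split; [exact: up_subedge..|].
have sepl b c : @separated R k.+1 (inl u) (inl v)
    (inl (endpoint e b)) (inl (endpoint f c)).
  exact: sep.
have sepr b : @separated R k.+1 (inl u) (inl v)
    (inl (endpoint e b)) (inr (f, m)).
  apply/separated_sym/separated_inr => //; apply/separated_sym.
    exact: (sepl b false).
  exact: (sepl b true).
move=> b c; rewrite !endpoint_subdivide; case: ifP => _; case: ifP => _ //.
- apply: separated_inr => //; [exact: (sepl false)|exact: (sepl true)].
(* Two new vertices, distinct by the hypothesis [ne]. *)
- apply: separated_inr; [|exact: (sepr false)|exact: (sepr true)].
  by case=> eE nE; apply: ne; rewrite eE nE.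
Qed.

(** The relative heights are 0 or 1, so the identity only records the cut distances 0 and 2^-k
    between the ends. *)
Lemma branched_edge (R : realType) (k : nat) (e : edge (diamond k)) :
  branched R e e (ends e).1 (ends e).2.
Proof.
split; [by split; exact: up_refl..|].
have [dE hE] := cut_dist_edge R e.
rewrite /separated hE => - [] [] /=; rewrite /endpoint ?hE ?cut_distxx ?dE; try ring.
by rewrite cut_distC dE; ring.
Qed.

(** Halves of one edge through the same new vertex are equal or consecutive; through different new
    vertices they branch between the ends of that edge. Halves of distinct edges inherit the
    relation of those edges. *)
Lemma edge_cases (R : realType) (k : nat) (e f : edge (diamond k)) :
  [\/ e = f, up (ends e).2 (ends f).1, up (ends f).2 (ends e).1 |
      exists u v, branched R e f u v].
Proof.
elim: k e f => [|k IH]; first by move=> [] []; constructor 1.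
move=> [[e n] s] [[f m] t]; have [enfm|ne] := pselect ((e, n) = (f, m)).
  case: enfm => <- <-; case: s t => [] [].
  - by constructor 1.
  - by constructor 3; exact: up_refl.
  - by constructor 2; exact: up_refl.
  - by constructor 1.
have [ef|ef|ef|[u [v ef]]] := IH e f.
- constructor 4; exists (inl (ends e).1), (inl (ends e).2).
  by apply: branched_subdivide => //; rewrite -ef; exact: branched_edge.
- constructor 2; have [_ h] := up_subedge n s (conj (up_refl (ends e).1) ef).
  have [h' _] := up_subedge m t (conj (up_refl (ends f).1) (up_refl (ends f).2)).
  exact: up_trans h h'.
- constructor 3; have [_ h] := up_subedge m t (conj (up_refl (ends f).1) ef).
  have [h' _] := up_subedge n s (conj (up_refl (ends e).1) (up_refl (ends e).2)).
  exact: up_trans h h'.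
- by constructor 4; exists (inl u), (inl v); exact: branched_subdivide.
Qed.

(** * The lower bound by half the distance *)

Lemma vertex_endpoint (k : nat) (x : vertex (diamond k)) :
  exists e b, x = endpoint e b.
Proof.
elim: k x => [|k IH].
  by move=> []; exists tt; [exists false|exists true].
move=> [u|[e n]]; last by exists (e, n, false), true.
by have [e [b ->]] := IH u; exists (e, 0%N, b), b; rewrite endpoint_subdivide eqxx.
Qed.

Lemma up_endpoint (G : graph) (u v : vertex G) (e : edge G) (b : bool) :
  up u (ends e).1 /\ up (ends e).2 v -> up u (endpoint e b) /\ up (endpoint e b) v.
Proof.
move=> [ue ev]; have ee := up_edge e.
by case: b; split => //; [exact: up_trans ue ee|exact: up_trans ee ev].
Qed.

(** If a + b <= L, then 2 d L - (a + b) L = (a + b) (L - a - b) + (a - b)^2 >= 0. The other case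
    follows in the same way after replacing a and b by L - a and L - b. *)
Lemma half_le_of_separated (F : realFieldType) (a b L D d : F) :
  0 < L -> 0 <= D -> D <= a + b -> D <= (L - a) + (L - b) ->
  d * L = a * (L - b) + b * (L - a) -> D / 2 <= d.
Proof.
move=> L0 D0 D1 D2 dE; rewrite -(ler_pM2r L0) dE.
have sq : 0 <= (a - b) ^+ 2 by exact: sqr_ge0.
have [sL|Ls] := leP (a + b) L.
  have h1 : 0 <= (a + b - D) * L by apply: mulr_ge0; lra.
  have h2 : 0 <= (a + b) * (L - (a + b)) by apply: mulr_ge0; lra.
  nra.
have h1 : 0 <= (L - a + (L - b) - D) * L by apply: mulr_ge0; lra.
have h2 : 0 <= (L - a + (L - b)) * (a + b - L) by apply: mulr_ge0; lra.
nra.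
Qed.

Lemma up_height (R : realType) (k : nat) (x y : vertex (diamond k)) : up x y ->
  height R x <= height R y.
Proof.
move=> /(dist_up R) /(le_trans (ler0n _ _)).
by rewrite pmulr_rge0 ?exprn_gt0// subr_ge0.
Qed.

Lemma dist_le_cut_dist (R : realType) (k : nat) (x y : vertex (diamond k)) :
  ~ same_vertical_path x y -> (dist x y)%:R / 2 <= 2 ^+ k * cut_dist R x y.
Proof.
move=> nxy.
have nup : ~ up x y by move=> /(up_ascending R) xy; apply: nxy; left.
have nup' : ~ up y x by move=> /(up_ascending R) yx; apply: nxy; right.
have [e [b xE]] := vertex_endpoint x; have [f [c yE]] := vertex_endpoint y.
have e_up (a : edge (diamond k)) d :
    up (ends a).1 (endpoint a d) /\ up (endpoint a d) (ends a).2.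
  by apply: up_endpoint; split; exact: up_refl.
have [ef|ef|ef|[u [v [ue uf /(_ b c)]]]] := edge_cases R e f.
(* The first three cases would put x and y on a vertical path. *)
- exfalso; move: nup nup'; rewrite xE yE -ef; case: b c {xE yE} => [] [] n1 n2;
  by [apply: n1; exact: up_refl|apply: n1; exact: up_edge|apply: n2; exact: up_edge].
- case: nup; rewrite xE yE; apply: up_trans (e_up e b).2 (up_trans ef (e_up f c).1).
- case: nup'; rewrite xE yE; apply: up_trans (e_up f c).2 (up_trans ef (e_up e b).1).
rewrite -xE -yE /separated => sep.
have [ux xv] := up_endpoint b ue; have [uy yv] := up_endpoint c uf.
rewrite -xE in ux xv; rewrite -yE in uy yv.
(* The detours through u and through v give the two upper bounds on D in [half_le_of_separated]. *)
have h1 : (dist x y)%:R <= 2 ^+ k * (height R x - height R u) +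
                           2 ^+ k * (height R y - height R u).
  apply: le_trans (lerD (dist_up R ux) (dist_up R uy)).
  by rewrite -natrD ler_nat [dist u x]dist_sym dist_trans.
have h2 : (dist x y)%:R <= 2 ^+ k * (height R v - height R x) +
                           2 ^+ k * (height R v - height R y).
  apply: le_trans (lerD (dist_up R xv) (dist_up R yv)).
  by rewrite -natrD ler_nat [dist y v]dist_sym dist_trans.
have uv : height R u < height R v.
  apply: le_lt_trans (up_height R ue.1) _; apply: lt_le_trans (up_height R ue.2).
  by rewrite height_edge ltrDl invr_gt0 exprn_gt0.
pose P : R := 2 ^+ k; have P0 : 0 < P by rewrite exprn_gt0.
apply: (@half_le_of_separated _ (P * (height R x - height R u))
  (P * (height R y - height R u)) (P * (height R v - height R u))) => //.
- by rewrite mulr_gt0// subr_gt0.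
- apply: le_trans h2 _; rewrite -/P le_eqVlt; apply/orP; left; apply/eqP; ring.
- rewrite -/P mulrACA sep; ring.
Qed.

(** * Scaled indicator functions in the space L1 *)

Lemma Lnorm1_scaled_events (R : realType) (c : R) (g h : R -> bool) :
  0 <= c -> event g -> event h ->
  'N[lebesgue01 R]_1[(fun s => (c * (g s)%:R - c * (h s)%:R)%:E)]%E =
  (c * pr (fun s => g s != h s))%:E.
Proof.
move=> c0 mg mh; have mgh := event_neq mg mh.
rewrite Lnorm1 EFinM -(pr_fin mgh) -[X in lebesgue01 R X]setIT.
rewrite -integral_indic//; last exact: event_measurable.
rewrite -ge0_integralZl_EFin//; last first.
- by apply/measurable_EFinP; apply: measurable_indic; exact: event_measurable.
apply: eq_integral => s _; rewrite -EFinM abse_EFin indicE; congr (_%:E).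
rewrite -mulrBr normrM (ger0_norm c0); congr (c * _).
have -> : (s \in [set s | g s != h s]) = (g s != h s).
  by apply/idP/idP; rewrite inE.
by case: (g s); case: (h s); rewrite ?subrr ?subr0 ?sub0r ?normrN ?normr0 ?normr1.
Qed.

Lemma event_L1 (R : realType) (c : R) (g : R -> bool) : 0 <= c -> event g ->
  exists F : L1_01 R,
    exists2 f : {mfun measurableTypeR R >-> measurableTypeR R},
      (F : R -> R) = f %[ae lebesgue01 R] & forall s, f s = c * (g s)%:R.
Proof.
move=> c0 mg.
have mf : measurable_fun [set: measurableTypeR R]
    (fun s : measurableTypeR R => c * (g s)%:R : measurableTypeR R).
  apply: measurable_funM; first exact: measurable_cst.
  rewrite (_ : (fun _ => _) = \1_[set s | g s]).
    by apply: measurable_indic; exact: event_measurable.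
  apply/funext => s; rewrite indicE; congr (nat_of_bool _)%:R.
  by apply/idP/idP; rewrite inE.
pose f : {mfun measurableTypeR R >-> measurableTypeR R} :=
  @mfun_Sub _ _ (measurableTypeR R) (measurableTypeR R) _ (mem_set mf).
have fE s : f s = c * (g s)%:R by [].
have fN : finite_norm (lebesgue01 R) 1 (f : measurableTypeR R -> R).
  have m0 : event (fun _ : R => false) by exact: measurable_cst.
  (* The norm of f is that of its difference with the scaled indicator of the empty event. *)
  rewrite /finite_norm; apply: le_lt_trans (ltry (c * pr (fun s => g s != false))).
  rewrite -(Lnorm1_scaled_events c0 mg m0) le_eqVlt; apply/orP; left; apply/eqP.
  by congr Lnorm; apply/funext => s /=; rewrite mulr0 subr0.
have [F FE] := L1_class fN; exists F, f => //.
Qed.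

Local Open Scope ereal_scope.

Theorem theorem3p3 (R : realType) (k : nat) :
  exists Psi : vertex (diamond k) -> L1_01 R,
    forall x y : vertex (diamond k),
      (same_vertical_path x y ->
         L1_dist (Psi x) (Psi y) = (dist x y)%:R%:E) /\
      (~ same_vertical_path x y ->
         ((dist x y)%:R / 2)%:E <= L1_dist (Psi x) (Psi y) /\
         L1_dist (Psi x) (Psi y) <= (dist x y)%:R%:E).
Proof.
have c0 : (0 <= 2 ^+ k :> R)%R by rewrite exprn_ge0.
have [Psi PsiE] := choice (fun x => event_L1 c0 (@side_event R k x)).
have Psi_dist x y : L1_dist (Psi x) (Psi y) = (2 ^+ k * cut_dist R x y)%:E.
  have [f Ff fE] := PsiE x; have [g Fg gE] := PsiE y.
  rewrite (L1_dist_repr Ff Fg) -Lnorm1_scaled_events//; try exact: side_event.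
  by congr Lnorm; apply/funext => s; rewrite fE gE.
exists Psi => x y; rewrite !Psi_dist !lee_fin; split.
  case=> /(ascending_cut_dist R) E; first by rewrite E.
  by rewrite cut_distC dist_sym E.
by move=> nxy; split; [exact: dist_le_cut_dist|exact: cut_dist_le_dist].
Qed.
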